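(* Let $q$ be a prime power, $2\le n\le m$ integers, $\mathcal{C}\le\mathbb{F}_q^{n\times m}$ an $\mathbb{F}_q$-linear subspace of dimension $k$ with dual $\mathcal{C}^\perp$, and $0\le i\le k$. For all $0\le w\le n$, $$A_w^{(i)}(\mathcal{C})=\sum_{u=0}^w(-1)^{w-u}q^{\binom{w-u}{2}}\begin{bmatrix} n-u \\ n-w \end{bmatrix}_q\sum_{j=0}^i\frac{q^{j(k+mu+j)}}{q^{j(mn+i)}}\begin{bmatrix} k-m(n-u) \\ i-j \end{bmatrix}_q\sum_{t=0}^{n-u}\begin{bmatrix} n-t \\ u \end{bmatrix}_qA_t^{(j)}(\mathcal{C}^\perp).$$
   Context: The dual is $\mathcal{C}^\perp=\{N\in\mathbb{F}_q^{n\times m}:\operatorname{Tr}(MN^t)=0 \text{ for all } M\in\mathcal{C}\}$. For a subspace $\mathcal{E}$ of matrices, $\operatorname{colsupp}(\mathcal{E})=\sum_{M\in\mathcal{E}}\operatorname{colsp}(M)$ and $\operatorname{rowsupp}(\mathcal{E})=\sum_{M\in\mathcal{E}}\operatorname{rowsp}(M)$, where $\operatorname{colsp}(M)\le\mathbb{F}_q^n$, $\operatorname{rowsp}(M)\le\mathbb{F}_q^m$ are column and row spaces. $q$-binomial coefficient: for integers $a,b$, $\begin{bmatrix} a \\ b \end{bmatrix}_q$ is $0$ if $b<0$ or $0\le a<b$; $1$ if $b=0$; $\prod_{s=1}^b\frac{q^{a-s+1}-1}{q^s-1}$ if $b>0$ and $a\ge b$; and $(-1)^bq^{ab-\binom b2}\begin{bmatrix}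 -a+b-1 \\ b \end{bmatrix}_q$ if $b>0$ and $a<0$. Generalized rank weight distribution: for a subspace $\mathcal{D}\le\mathbb{F}_q^{n\times m}$, an integer $j\ge0$ and $W\le\mathbb{F}_q^n$ let $A_W^{(j)}(\mathcal{D},c)$ (respectively, for $n=m$, $A_W^{(j)}(\mathcal{D},r)$) be the number of $j$-dimensional subspaces $\mathcal{E}\le\mathcal{D}$ with $\operatorname{colsupp}(\mathcal{E})=W$ (respectively $\operatorname{rowsupp}(\mathcal{E})=W$). For $0\le w\le n$, $A_w^{(j)}(\mathcal{D})=\sum_{\dim W=w}A_W^{(j)}(\mathcal{D},c)$ if $n<m$, and $A_w^{(j)}(\mathcal{D})=\frac12\sum_{\dim W=w}\big(A_W^{(j)}(\mathcal{D},c)+A_W^{(j)}(\mathcal{D},r)\big)$ if $n=m$, sums over $W\le\mathbb{F}_q^n$. *)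

(* Defs.v *)
From HB Require Import structures.
From mathcomp Require Import all_boot all_order all_algebra.

Set Implicit Arguments.
Unset Strict Implicit.
Unset Printing Implicit Defensive.

Import Order.TTheory GRing.Theory Num.Theory.
Local Open Scope ring_scope.

(* Over a finite field the library only makes {vspace vT} a choiceType; as a
   subtype of square matrices it is finite, so subspaces can be counted. *)
Section FiniteVspace.
Import VectorInternalTheory.
Variables (F : finFieldType) (vT : vectType F).
HB.instance Definition _ := [Countable of {vspace vT} by <:].
HB.instance Definition _ := [Finite of {vspace vT} by <:].
End FiniteVspace.

Section RankMetric.
Variable F : finFieldType.
Implicit Types n m j w : nat.

(* F^n is 'rV[F]_n for both kinds of spaces, so columns are transposed. *)
Definition colsp n m (M : 'M[F]_(n, m)) : {vspace 'rV[F]_n} :=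
  <<[seq (col l M)^T | l : 'I_m]>>%VS.

Definition rowsp n m (M : 'M[F]_(n, m)) : {vspace 'rV[F]_m} :=
  <<[seq row l M | l : 'I_n]>>%VS.

Definition colsupp n m (E : {vspace 'M[F]_(n, m)}) : {vspace 'rV[F]_n} :=
  (\sum_(M : 'M[F]_(n, m) | M \in E) colsp M)%VS.

Definition rowsupp n m (E : {vspace 'M[F]_(n, m)}) : {vspace 'rV[F]_m} :=
  (\sum_(M : 'M[F]_(n, m) | M \in E) rowsp M)%VS.

Definition in_dual n m (C : {vspace 'M[F]_(n, m)}) : pred 'M[F]_(n, m) :=
  fun N => [forall (M | M \in C), \tr (M *m N^T) == 0].

(* The span makes the defining set a {vspace _}; it adds nothing, by dualP. *)
Definition dual n m (C : {vspace 'M[F]_(n, m)}) : {vspace 'M[F]_(n, m)} :=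
  <<enum (in_dual C)>>%VS.

Lemma dualP n m (C : {vspace 'M[F]_(n, m)}) (N : 'M[F]_(n, m)) :
  reflect (forall M, M \in C -> \tr (M *m N^T) = 0) (N \in dual C).
Proof.
apply: (iffP idP) => [/(@coord_span _ _ _ (in_tuple _)) -> M MC | NC].
  rewrite linear_sum /= linear_sum /= linear_sum big1 //= => l _.
  rewrite linearZ /= -scalemxAr linearZ /=.
  have : (enum (in_dual C))`_l \in enum (in_dual C) by apply: mem_nth.
  by rewrite mem_enum => /forall_inP/(_ M MC)/eqP->; rewrite mulr0.
apply: memv_span; rewrite mem_enum; apply/forall_inP => M MC.
by apply/eqP/NC.
Qed.

Definition Acol n m (D : {vspace 'M[F]_(n, m)}) j (W : {vspace 'rV[F]_n}) : nat :=
  #|[set E : {vspace 'M[F]_(n, m)} |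
      [&& (E <= D)%VS, \dim E == j & colsupp E == W]]|.

Definition Arow n m (D : {vspace 'M[F]_(n, m)}) j (W : {vspace 'rV[F]_m}) : nat :=
  #|[set E : {vspace 'M[F]_(n, m)} |
      [&& (E <= D)%VS, \dim E == j & rowsupp E == W]]|.

(* Meant for n <= m, so the last branch is n = m. The two sums are kept apart
   there because 'rV[F]_n and 'rV[F]_m are then only propositionally equal. *)
Definition gwdist n m (D : {vspace 'M[F]_(n, m)}) j w : rat :=
  if (n < m)%N then
    (\sum_(W : {vspace 'rV[F]_n} | \dim W == w) Acol D j W)%:R
  else
    2%:R^-1 * (\sum_(W : {vspace 'rV[F]_n} | \dim W == w) (Acol D j W)%:R
             + \sum_(W : {vspace 'rV[F]_m} | \dim W == w) (Arow D j W)%:R).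

End RankMetric.

(* Case b > 0 and a >= 0 of the q-binomial coefficient; the truncated
   subtraction is exact since s <= b <= a. *)
Definition qbinom_nat (q a b : nat) : rat :=
  if (a < b)%N then 0
  else \prod_(1 <= s < b.+1) ((q%:R ^+ (a - s + 1) - 1) / (q%:R ^+ s - 1)).

(* In the last case a < 0 < b, so the absolute value of - a + b - 1 is only a
   conversion to nat. *)
Definition qbinom (q : nat) (a b : int) : rat :=
  if b < 0 then 0
  else if b == 0 then 1
  else if 0 <= a then qbinom_nat q (absz a) (absz b)
  else (-1) ^+ absz b * q%:R ^ (a * b - 'C(absz b, 2)%:Z)
       * qbinom_nat q (absz (- a + b - 1)%R) (absz b).

(* Main.v *)
Require Import Defs.
From HB Require Import structures.
From mathcomp Require Import all_boot all_order all_algebra.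
From mathcomp Require Import finfield zify ring.

Import Order.TTheory GRing.Theory Num.Theory.
Local Open Scope ring_scope.

(* For U <= F^n of dimension u let S(U) be the space of matrices supported in
   U.  Since dim S(U) = m u and the dual of S(U) is S(U^perp), comparing
   dimensions gives
     dim (C :&: S(U)) = k - m (n - u) + dim (C^perp :&: S(U^perp)).
   The i-dimensional subspaces of C supported in U are therefore counted by the
   q-binomial of the right-hand side, which the q-Vandermonde identity (valid
   for the possibly negative k - m (n - u)) expands in terms of the subspaces
   of C^perp supported in U^perp.  Summing over U of dimension u gives moment
   identities, and Gaussian Moebius inversion isolates the weight w.  Column and
   row supports are handled simultaneously, through the adjunction
   supp E <= U <-> E <= S(U). *)

(* The product makes sense for all integers a; qbinomE matches it with the
   case distinction of qbinom. *)
Definition gbin (x : rat) (a : int) (b : nat) : rat :=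
  \prod_(s < b) ((x ^ (a - s%:Z) - 1) / (x ^+ s.+1 - 1)).

Lemma gbin0 x a : gbin x a 0 = 1.
Proof. by rewrite /gbin big_ord0. Qed.

Lemma gbinSr x a b :
  gbin x a b.+1 = gbin x a b * ((x ^ (a - b%:Z) - 1) / (x ^+ b.+1 - 1)).
Proof. by rewrite /gbin big_ord_recr. Qed.

Lemma gbin_small x (a b : nat) : (a < b)%N -> gbin x a b = 0.
Proof.
move=> ab; rewrite /gbin (bigD1 (Ordinal ab)) //=.
by rewrite subrr expr0z subrr mul0r mul0r.
Qed.

(** * Gaussian binomials with an arbitrary integer upper argument *)

Section Gaussian.
Variable x : rat.
Hypothesis x_gt1 : 1 < x.

Let x_neq0 : x != 0.
Proof. by rewrite gt_eqF // (lt_trans _ x_gt1). Qed.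

Let qint_neq0 b : x ^+ b.+1 - 1 != 0.
Proof. by rewrite subr_eq0 gt_eqF // exprn_egt1. Qed.

(** Passing from [a] to [a + 1] shifts the numerators by one index, so the only new numerator is
    [x ^ (a + 1) - 1]. Both Pascal rules follow, by the two ways of splitting it along
    [x ^ (a + 1) = x ^ (a - b) * x ^+ b.+1]. *)
Lemma gbinSS a b :
  gbin x (a + 1) b.+1 = gbin x a b * ((x ^ (a + 1) - 1) / (x ^+ b.+1 - 1)).
Proof.
elim: b => [|b IH]; first by rewrite gbinSr !gbin0 subr0.
rewrite gbinSr IH gbinSr.
have -> : a + 1 - b.+1%:Z = a - b%:Z by lia.
ring.
Qed.

Lemma gbin_pascal a b :
  gbin x (a + 1) b.+1 = gbin x a b.+1 + x ^ (a - b%:Z) * gbin x a b.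
Proof.
rewrite gbinSS gbinSr.
have -> : x ^ (a + 1) = x ^ (a - b%:Z) * x ^+ b.+1.
  by rewrite exprnP -expfzDr //; congr (_ ^ _); lia.
by field.
Qed.

Lemma gbin_pascal' a b :
  gbin x (a + 1) b.+1 = x ^+ b.+1 * gbin x a b.+1 + gbin x a b.
Proof.
rewrite gbinSS gbinSr.
have -> : x ^ (a + 1) = x ^ (a - b%:Z) * x ^+ b.+1.
  by rewrite exprnP -expfzDr //; congr (_ ^ _); lia.
by field.
Qed.

(** Induction on [l] for all [a] at once: one unit moves from [l.+1] to [a], and one Pascal rule is
    applied to each of the two binomials. *)
Lemma gbin_vandermonde (l i : nat) (a : int) :
  gbin x (a + l%:Z) i =
  \sum_(j < i.+1) x ^ (j%:Z * (a - i%:Z + j%:Z)) * gbin x a (i - j) * gbin x l j.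
Proof.
elim: l i a => [|l IH] i a.
  rewrite addr0 big_ord_recl /= mul0r expr0z gbin0 mul1r mulr1 subn0.
  by rewrite big1 ?addr0 // => j _; rewrite [gbin x 0 _]gbin_small ?mulr0.
have -> : a + l.+1%:Z = (a + 1) + l%:Z by lia.
rewrite IH; case: i => [|i]; first by rewrite !big_ord1 !gbin0 !mul0r.
pose P j := x ^ (j%:Z * (a - i%:Z + j%:Z)) * gbin x a (i.+1 - j) * gbin x l j.
pose Q j := x ^ (j.+1%:Z * (a - i%:Z + j%:Z)) * gbin x a (i - j) * gbin x l j.
(* Splitting [gbin x (a + 1) _] on the left gives [P j + Q j], the last index giving only [P].
   Splitting [gbin x l.+1 _] on the right gives [P j.+1 + Q j], index 0 giving only [P 0]. *)
transitivity (\sum_(j < i.+2) P j + \sum_(j < i.+1) Q j).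
  rewrite [LHS]big_ord_recr /= [X in _ = X + _]big_ord_recr /= [RHS]addrAC.
  rewrite -big_split /=; congr (_ + _).
    apply: eq_bigr => j _; rewrite /P /Q subSn -1?ltnS // gbin_pascal.
    have -> : a + 1 - i.+1%:Z + j%:Z = a - i%:Z + j%:Z by lia.
    have -> : x ^ (j.+1%:Z * (a - i%:Z + j%:Z))
              = x ^ (j%:Z * (a - i%:Z + j%:Z)) * x ^ (a - (i - j)%N%:Z).
      by rewrite -expfzDr //; congr (_ ^ _); have := ltn_ord j; lia.
    ring.
  by rewrite /P subnn !gbin0; congr (_ ^ _ * _ * _); lia.
rewrite [LHS]addrC [X in _ + X = _]big_ord_recl addrCA -big_split /= [RHS]big_ord_recl.
congr (_ + _); first by rewrite /P /= !mul0r !gbin0.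
apply: eq_bigr => j _; rewrite /P /Q /= /bump /= add1n !subSS.
have -> : l.+1%:Z = l%:Z + 1 by lia.
have -> : a - i.+1%:Z + j.+1%:Z = a - i%:Z + j%:Z by lia.
have -> : x ^ (j.+1%:Z * (a - i%:Z + j.+1%:Z))
          = x ^ (j.+1%:Z * (a - i%:Z + j%:Z)) * x ^+ j.+1.
  by rewrite exprnP -expfzDr //; congr (_ ^ _); lia.
rewrite gbin_pascal'; ring.
Qed.

(* The sum telescopes by the Pascal rule. *)
Lemma gbin_alternating (r : nat) :
  \sum_(s < r.+1) (-1) ^+ s * x ^+ 'C(s, 2) * gbin x r s = (r == 0)%:R.
Proof.
case: r => [|r]; first by rewrite big_ord1 gbin0.
pose P s := (-1) ^+ s * x ^+ 'C(s.+1, 2) * gbin x r s.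
have PS s : (-1) ^+ s.+1 * x ^+ 'C(s.+1, 2) * gbin x r.+1 s.+1 = P s.+1 - P s.
  have -> : r.+1%:Z = r%:Z + 1 by lia.
  rewrite /P gbin_pascal' (binS s.+1 1) bin1 exprD !exprS; ring.
rewrite big_ord_recl /=.
under eq_bigr => s _ do rewrite /bump /= add1n PS.
rewrite -(big_mkord xpredT (fun s => P s.+1 - P s)) telescope_sumr //.
by rewrite /P [gbin x r r.+1]gbin_small // !gbin0; ring.
Qed.

(** This is [(x - 1) ^+ a] times the usual q-factorial of [a]. *)
Definition qfact (a : nat) : rat := \prod_(s < a) (x ^+ s.+1 - 1).

Lemma qfact_neq0 a : qfact a != 0.
Proof. by apply/prodf_neq0 => s _; exact: qint_neq0. Qed.

Lemma gbin_qfact (a b : nat) :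
  (b <= a)%N -> gbin x a b = qfact a / (qfact b * qfact (a - b)).
Proof.
elim: a b => [|a IH] [|b] ba //.
- by rewrite gbin0 /qfact !big_ord0.
- by rewrite gbin0 subn0 /qfact big_ord0 mul1r divff ?qfact_neq0.
have -> : a.+1%:Z = a%:Z + 1 by lia.
rewrite gbinSS IH // subSS.
have qfactS c : qfact c.+1 = qfact c * (x ^+ c.+1 - 1).
  by rewrite /qfact big_ord_recr.
have -> : x ^ (a%:Z + 1) = x ^+ a.+1 by rewrite exprnP; congr (_ ^ _); lia.
rewrite !qfactS; field.
by rewrite !qfact_neq0 qint_neq0.
Qed.

Lemma gbin_nn (a : nat) : gbin x a a = 1.
Proof.
by rewrite gbin_qfact // subnn /qfact big_ord0 mulr1 divff // qfact_neq0.
Qed.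

(** Both sides are the q-trinomial [qfact (n - t) / (qfact (n - w) * qfact (w - u) * qfact (u -
    t))]. *)
Lemma gbin_trinomial (n t u w : nat) : (t <= u)%N -> (u <= w)%N -> (w <= n)%N ->
  gbin x (n - u)%N (n - w) * gbin x (n - t)%N (n - u) =
  gbin x (n - t)%N (n - w) * gbin x (w - t)%N (w - u).
Proof.
move=> tu uw wn; rewrite !gbin_qfact; try lia.
have -> : (n - u - (n - w) = w - u)%N by lia.
have -> : (n - t - (n - u) = u - t)%N by lia.
have -> : (n - t - (n - w) = w - t)%N by lia.
have -> : (w - t - (w - u) = u - t)%N by lia.
by field; rewrite !qfact_neq0.
Qed.

(** After the trinomial identity, one binomial no longer depends on [u]. With the sums exchanged,
    the coefficient of [A t] contains an alternating sum over [u] that vanishes unless [t = w]. *)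
Lemma gbin_inversion (n w : nat) (A : nat -> rat) : (w <= n)%N ->
  \sum_(0 <= u < w.+1) (-1) ^+ (w - u) * x ^+ 'C(w - u, 2)
    * gbin x (n - u)%N (n - w)
    * \sum_(0 <= t < u.+1) gbin x (n - t)%N (n - u) * A t = A w.
Proof.
move=> wn.
pose c u t := (-1) ^+ (w - u) * x ^+ 'C(w - u, 2) * gbin x (w - t)%N (w - u).
transitivity (\sum_(0 <= u < w.+1) \sum_(0 <= t < w.+1 | (t <= u)%N)
                c u t * (gbin x (n - t)%N (n - w) * A t)).
  apply: eq_big_nat => u /andP[_ uw].
  rewrite mulr_sumr (big_nat_widen 0 u.+1 w.+1) //=.
  apply: eq_big => [t|t]; rewrite ltnS // => tu.
  rewrite /c -mulrA [gbin _ _ _ * (_ * _)]mulrA gbin_trinomial //; ring.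
have sum_c t : (t <= w)%N -> \sum_(0 <= u < w.+1 | (t <= u)%N) c u t = (t == w)%:R.
  move=> tw.
  have -> : \sum_(0 <= u < w.+1 | (t <= u)%N) c u t
            = \sum_(t <= u < w.+1) c u t.
    by rewrite [RHS](big_nat_widenl t 0).
  (* Reversing and shifting the range makes [s = w - u] the index, which is [gbin_alternating] for
     [r = w - t]. *)
  rewrite big_nat_rev /= -{1}[t]add0n big_addn.
  rewrite subSn // big_mkord.
  under eq_bigr => s _.
    rewrite /c; have -> : (w - (t + w.+1 - (s + t).+1) = s)%N.
      by have := ltn_ord s; lia.
    over.
  by rewrite gbin_alternating subn_eq0 eqn_leq tw.
rewrite (exchange_big_dep_nat xpredT) //=.
under eq_big_nat => t /andP[_ tw] do rewrite -mulr_suml sum_c -1?ltnS //.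
rewrite big_nat_recr //= eqxx mul1r.
rewrite big_nat_cond big1 ?add0r => [|t]; last first.
  by rewrite andbT => /andP[_ /ltn_eqF ->]; rewrite mul0r.
by rewrite gbin_nn mul1r.
Qed.
End Gaussian.

(** For [a < 0 < b], write each numerator [q ^ e - 1] with [e = a - s] as
    [- q ^ e * (q ^ (- e) - 1)]. The factors [- q ^ e] multiply to the sign and the power of [q];
    the others are the numerators for [- a + b - 1] in reverse order. *)
Lemma qbinomE (q : nat) (a : int) (b : nat) : (1 < q)%N ->
  qbinom q a b%:Z = gbin q%:R a b.
Proof.
move=> q1; rewrite /qbinom /=; case: eqP => [[->]|/eqP b0]; first by rewrite gbin0.
have q0 : q%:R != 0 :> rat by rewrite pnatr_eq0; lia.
case: ifPn => [a0|]; last rewrite -ltNge => a0.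
  case: a a0 => // a _; rewrite /qbinom_nat /=.
  case: ltnP => ab; first by rewrite gbin_small.
  rewrite big_add1 big_mkord; apply: eq_bigr => s _.
  congr ((_ - _) / _); rewrite exprnP; congr (_ ^ _).
  by case: s => s /= sb; lia.
(* As [a <= -1], the upper argument [- a + b - 1] is at least [b], which excludes the zero
   branch. *)
rewrite /qbinom_nat ifF; last by apply/negbTE; rewrite -leqNgt; lia.
set c := absz _; have cE : c%:Z = - a + b%:Z - 1 by rewrite /c; lia.
rewrite /gbin !prodf_div mulrA; congr (_ / _); last first.
  by rewrite big_add1 big_mkord.
have -> : (-1) ^+ b * q%:R ^ (a * b%:Z - 'C(b, 2)%:Z)
   = \prod_(s < b) (- q%:R ^ (a - s%:Z)) :> rat.
  rewrite prodrN card_ord; congr (_ * _).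
  elim: {b0 c cE} b => [|b IH]; first by rewrite big_ord0 mulr0.
  rewrite big_ord_recr /= -IH -expfzDr //; congr (_ ^ _).
  by rewrite binS bin1; lia.
rewrite big_add1 big_mkord [X in _ * X](reindex_inj rev_ord_inj) /= -big_split /=.
apply: eq_bigr => s _.
have -> : q%:R ^+ (c - (b - s.+1).+1 + 1) = q%:R ^ (- (a - s%:Z)) :> rat.
  by rewrite exprnP; congr (_ ^ _); case: s => s /= sb; lia.
by rewrite mulrBr mulNr -expfzDr // subrr expr0z mulr1 opprK addrC.
Qed.

(** * Counting subspaces over a finite field *)

Section CountSubspaces.
Variables (F : finFieldType) (m n : nat).
Local Notation vT := 'M[F]_(m, n).
Implicit Types U E : {vspace vT}.
Let q : rat := #|F|%:R.

Let q_gt1 : 1 < q.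
Proof. by rewrite /q ltr1n finNzRing_gt1. Qed.

Definition free_tuples U j : {set j.-tuple vT} :=
  [set t : j.-tuple vT | free t && (<<t>> <= U)%VS].

(** A free tuple of length [j.+1] is a free tuple of length [j] with a new head outside its span, a
    set of [q ^+ j] vectors. *)
Lemma card_free_tuples U j :
  #|free_tuples U j|%:R = \prod_(s < j) (q ^+ \dim U - q ^+ s) :> rat.
Proof.
elim: j => [|j IH].
  rewrite big_ord0 (_ : free_tuples U 0 = [set [tuple]]) ?cards1 //.
  apply/setP => t; rewrite !inE tuple0 nil_free span_nil sub0v.
  by rewrite eqxx.
rewrite big_ord_recr /= -IH -!sum1_card !natr_sum mulr_suml.
rewrite (reindex (fun p : j.-tuple vT * vT => cons_tuple p.2 p.1)) /=; last first.
  exists (fun t : j.+1.-tuple vT => ([tuple of behead t], thead t)) => [[t x]|t] _.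
    by congr pair; apply/val_inj.
  by case/tupleP: t => x t; apply/val_inj.
transitivity (\sum_(t in free_tuples U j)
                \sum_(x | (x \in U) && (x \notin <<t>>%VS)) (1 : rat)).
  rewrite pair_big_dep /=; apply: eq_bigl => -[t x]; rewrite !inE /=.
  rewrite free_cons span_cons subv_add -memvE.
  by case: (free t); case: (x \in U); case: (_ <= _)%VS; rewrite ?andbT ?andbF.
apply: eq_bigr => t; rewrite inE => /andP[/eqP ft tU]; rewrite mul1r.
have cardq (E : {vspace vT}) : q ^+ \dim E = #|[set x in E]|%:R.
  by rewrite cardsE card_vspace natrX.
have -> : q ^+ j = #|[set x in <<t>>%VS]|%:R by rewrite -cardq ft size_tuple.
rewrite cardq -(cardsID [set x in <<t>>%VS] [set x in U]).
have /setIidPr -> : [set x in <<t>>%VS] \subset [set x in U].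
  by apply/subsetP => x; rewrite !inE; apply/subvP.
rewrite natrD addrC addKr -sum1_card natr_sum.
by apply: eq_bigl => x; rewrite !inE andbC.
Qed.

(** The free [j]-tuples in [U] are grouped by their span: each [j]-dimensional subspace has the same
    nonzero number of ordered bases. *)
Lemma card_subspaces U j :
  #|[set E : {vspace vT} | (E <= U)%VS & \dim E == j]|%:R
  = gbin q (\dim U) j.
Proof.
have E_neq0 : \prod_(s < j) (q ^+ j - q ^+ s) != 0.
  apply/prodf_neq0 => s _; rewrite subr_eq0 gt_eqF // ltr_eXn2l //.
apply: (mulIf E_neq0).
transitivity (#|free_tuples U j|%:R : rat).
  rewrite -!sum1_card !natr_sum mulr_suml.
  rewrite (partition_big (fun t : j.-tuple vT => <<t>>%VS)
    [in [set E : {vspace vT} | (E <= U)%VS & \dim E == j]]) /=; last first.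
    by move=> t; rewrite !inE => /andP[/eqP -> ->]; rewrite size_tuple eqxx.
  apply: eq_bigr => E; rewrite inE => /andP[EU /eqP dimE].
  have -> : \prod_(s < j) (q ^+ j - q ^+ s) = \prod_(s < j) (q ^+ \dim E - q ^+ s).
    by rewrite dimE.
  rewrite mul1r -card_free_tuples -sum1_card natr_sum.
  apply: eq_bigl => t; rewrite !inE.
  apply/andP/andP => [[ft tE]|[/andP[ft tU] /eqP <-]]; last by rewrite ft subvv.
  have -> : <<t>>%VS = E.
    by apply/eqP; rewrite eqEdim tE dimE (eqP ft) size_tuple leqnn.
  by rewrite ft EU eqxx.
(* With the denominators of [gbin] reversed, the factors match index by index once [q ^+ s] is taken
   out of [q ^+ \dim U - q ^+ s] and [q ^+ j - q ^+ s]. *)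
rewrite card_free_tuples /gbin prodf_div [X in _ / X](reindex_inj rev_ord_inj) /=.
rewrite -prodf_div -big_split /=; apply: eq_bigr => s _.
have q0 : q != 0 by rewrite gt_eqF // (lt_trans _ q_gt1).
have -> : q ^+ j = q ^+ s * q ^+ (j - s.+1).+1.
  by rewrite -exprD; congr (_ ^+ _); have := ltn_ord s; lia.
have -> : q ^+ \dim U = q ^+ s * q ^ ((\dim U)%:Z - s%:Z).
  by rewrite !exprnP -expfzDr //; congr (_ ^ _); lia.
field.
by rewrite subr_eq0 gt_eqF // exprn_egt1.
Qed.
End CountSubspaces.

(** * Orthogonality for the trace form *)

Section Duality.
Variables (F : finFieldType) (n m : nat).
Implicit Types (C D : {vspace 'M[F]_(n, m)}) (M N : 'M[F]_(n, m)).

Lemma mxtrace_mulmx_mxvec M N : \tr (M *m N^T) = (mxvec M *m (mxvec N)^T) 0 0.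
Proof.
rewrite [RHS]mxE (reindex _ (curry_mxvec_bij _ _)) /=.
transitivity (\sum_i \sum_j M i j * N i j).
  by apply: eq_bigr => i _; rewrite mxE; apply: eq_bigr => j _; rewrite mxE.
by rewrite pair_bigA; apply: eq_bigr => -[i j] _ /=; rewrite mxE !mxvecE.
Qed.

(** Rank-nullity for the map [f] pairing [N] with a basis of [C]: its kernel is the dual, and it is
    onto because the basis matrix [B] has full row rank. *)
Lemma dim_dual C : (\dim (dual C) + \dim C = n * m)%N.
Proof.
pose B : 'M[F]_(\dim C, n * m) := \matrix_l mxvec (vbasis C)`_l.
have freeB : row_free B.
  apply: inj_row_free => v vB.
  have : \sum_l v 0 l *: (vbasis C)`_l = 0.
    apply: (can_inj mxvecK); rewrite linear0 -vB linear_sum mulmx_sum_row /=.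
    by apply: eq_bigr => l _; rewrite linearZ rowK.
  have /freeP vbF := basis_free (vbasisP C).
  by move=> /vbF v0; apply/rowP => l; rewrite v0 mxE.
pose f : 'Hom('M[F]_(n, m), 'rV[F]_(\dim C)) := linfun (mulmxr B^T \o mxvec).
have fE N l : f N 0 l = \tr ((vbasis C)`_l *m N^T).
  rewrite lfunE /= mxtrace_mulmx_mxvec !mxE.
  by apply: eq_bigr => s _; rewrite !mxE mulrC.
have kerf : lker f = dual C.
  apply/vspaceP => N; rewrite memv_ker; apply/eqP/dualP => [fN M MC | CN].
    rewrite (coord_vbasis MC) mulmx_suml linear_sum big1 //= => l _.
    by rewrite -scalemxAl linearZ /= -fE fN mxE mulr0.
  by apply/rowP => l; rewrite fE mxE CN // vbasis_mem // mem_nth ?size_tuple.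
have imf : limg f = fullv.
  apply/vspaceP => v; rewrite memvf.
  have /row_freeP[X BX] := freeB.
  (* With [X] a right inverse of [B], the product [X^T *m B^T] is the identity. *)
  apply/memv_imgP; exists (vec_mx (v *m X^T)); first exact: memvf.
  by rewrite lfunE /= vec_mxK -mulmxA -trmx_mul BX trmx1 mulmx1.
have := limg_ker_dim f fullv.
rewrite capfv kerf imf !dimvf.
have -> : dim 'rV[F]_(\dim C) = \dim C by exact: mul1n.
exact.
Qed.

Lemma dualK C : dual (dual C) = C.
Proof.
apply/esym/eqP; rewrite eqEdim; apply/andP; split.
  apply/subvP => M MC; apply/dualP => N /dualP/(_ M MC).
  by rewrite -mxtrace_tr trmx_mul trmxK.
by have := dim_dual C; have := dim_dual (dual C); lia.
Qed.

Lemma dualS C D : (C <= D)%VS -> (dual D <= dual C)%VS.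
Proof.
move=> /subvP CD; apply/subvP => N /dualP ND.
by apply/dualP => M /CD; exact: ND.
Qed.

Lemma dualD C D : dual (C + D) = (dual C :&: dual D)%VS.
Proof.
apply/eqP; rewrite eqEsubv subv_cap !dualS ?addvSl ?addvSr //=.
apply/subvP => N; rewrite memv_cap => /andP[/dualP NC /dualP ND].
apply/dualP => _ /memv_addP[M MC [M' MD ->]].
by rewrite mulmxDl linearD /= NC // ND // addr0.
Qed.

(** By biduality [C :&: D] is the dual of [dual C + dual D], whose dimension comes from the
    sum-intersection formula. *)
Lemma dim_cap_dual C D :
  (\dim (C :&: D) + n * m = \dim C + \dim D + \dim (dual C :&: dual D))%N.
Proof.
have := dim_dual (dual C + dual D); rewrite dualD !dualK.
have := dimv_sum_cap (dual C) (dual D).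
by have := dim_dual C; have := dim_dual D; lia.
Qed.

(* Dualizing turns spaces containing C into subspaces of dual C. *)
Lemma card_superspaces C v :
  #|[set D : {vspace 'M[F]_(n, m)} | (C <= D)%VS & \dim D == v]|%:R
  = if (v <= n * m)%N then gbin #|F|%:R (n * m - \dim C)%N (n * m - v) else 0.
Proof.
case: ifPn => [vN|vN]; last first.
  rewrite (_ : [set _ | _ & _] = set0) ?cards0 //.
  apply/setP => D; rewrite !inE; apply/negbTE; apply: contra vN.
  by move=> /andP[_ /eqP <-]; rewrite -(dim_dual D) leq_addl.
have <- : \dim (dual C) = (n * m - \dim C)%N by have := dim_dual C; lia.
rewrite -card_subspaces; congr (_%:R).
rewrite -(card_imset _ (can_inj dualK)); apply: eq_card => D.
apply/imsetP/idP => [[E]|]; rewrite !inE => /andP[].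
  move=> CE /eqP dE ->; rewrite dualS //=; apply/eqP; have := dim_dual E; lia.
move=> DC /eqP dD; exists (dual D); last by rewrite dualK.
rewrite inE -{1}[C]dualK dualS //=; apply/eqP; have := dim_dual D; lia.
Qed.
End Duality.

(** * Duality identities for an abstract support *)

Section SupportSystem.
Variables (F : finFieldType) (p r N c : nat).
Let q : rat := #|F|%:R.
(** Column supports will be the case [N = p], [c = r], and row supports the case [N = r], [c = p];
    [shadow U] stands for S(U). *)
Variable supp : {vspace 'M[F]_(p, r)} -> {vspace 'rV[F]_N}.
Variable shadow : {vspace 'rV[F]_N} -> {vspace 'M[F]_(p, r)}.
Hypothesis supp_shadow : forall E U, (supp E <= U)%VS = (E <= shadow U)%VS.
Hypothesis dim_shadow : forall U, \dim (shadow U) = (c * \dim U)%N.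
Hypothesis dual_shadow : forall U, dual (shadow U) = shadow (dual U).
Hypothesis dim_total : (p * r = c * N)%N.

Let q_gt1 : 1 < q.
Proof. by rewrite /q ltr1n finNzRing_gt1. Qed.

Definition card_supp (D : {vspace 'M[F]_(p, r)}) (j t : nat) : nat :=
  #|[set E : {vspace 'M[F]_(p, r)} |
      [&& (E <= D)%VS, \dim E == j & \dim (supp E) == t]]|.

Lemma card_supp_sum D j t :
  \sum_(W : {vspace 'rV[F]_N} | \dim W == t)
    #|[set E : {vspace 'M[F]_(p, r)} | [&& (E <= D)%VS, \dim E == j & supp E == W]]|
  = card_supp D j t.
Proof.
rewrite /card_supp -sum1_card (partition_big supp (fun W => \dim W == t)) /=.
  apply: eq_bigr => W /eqP dW; rewrite -sum1_card; apply: eq_bigl => E.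
  rewrite !inE -!andbA; congr (_ && (_ && _)).
  by case: eqP => [->|]; rewrite ?andbF // dW eqxx.
by move=> E; rewrite inE => /and3P[].
Qed.

(** Double count of the pairs [(E, U)] with [supp E <= U]. For fixed [U] the adjunction puts [E]
    inside [D :&: shadow U]; for fixed [E] the spaces [U] are the superspaces of [supp E]. *)
Lemma sum_gbin_shadow D j v : (v <= N)%N ->
  \sum_(U : {vspace 'rV[F]_N} | \dim U == v) gbin q (\dim (D :&: shadow U)) j
  = \sum_(0 <= t < v.+1) gbin q (N - t)%N (N - v) * (card_supp D j t)%:R.
Proof.
move=> vN; pose P (E : {vspace 'M[F]_(p, r)}) := (E <= D)%VS && (\dim E == j).
transitivity (\sum_(E | P E) gbin q (N - \dim (supp E))%N (N - v)).
  transitivity (\sum_(U : {vspace 'rV[F]_N} | \dim U == v)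
                  \sum_(E | P E && (supp E <= U)%VS) (1 : rat)).
    apply: eq_bigr => U _; rewrite -card_subspaces -sum1_card natr_sum.
    by apply: eq_bigl => E; rewrite inE subv_cap supp_shadow /P andbAC.
  rewrite (exchange_big_dep P) /=; last by move=> U E _ /andP[].
  apply: eq_bigr => E PE.
  have := card_superspaces _ _ _ (supp E) v; rewrite !mul1n vN => <-.
  rewrite -sum1_card natr_sum; apply: eq_bigl => U.
  by rewrite inE PE andbC.
transitivity (\sum_(0 <= t < v.+1) \sum_(E | P E && (\dim (supp E) == t))
                gbin q (N - t)%N (N - v)); last first.
  apply: eq_bigr => t _; rewrite sumr_const -[LHS]mulr_natr; congr (_ * _%:R).
  by apply: eq_card => E; rewrite inE unfold_in /P /= -andbA.
rewrite (exchange_big_dep P) /=; last by move=> t E _ /andP[].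
apply: eq_bigr => E PE; rewrite PE /=.
case: (leqP (\dim (supp E)) v) => dE.
  rewrite big_mkcond (bigD1_seq (\dim (supp E))) ?mem_index_iota ?iota_uniq //=.
  by rewrite eqxx big1 ?addr0 // => t; rewrite eq_sym => /negbTE->.
(* A support of dimension above [v] lies in no [U]. Here [dim_dual] supplies [\dim (supp E) <= N],
   so that the truncated subtractions compare strictly. *)
rewrite gbin_small; last by have := dim_dual _ _ _ (supp E); lia.
rewrite big_nat_cond big1 // => t /andP[/andP[_ tv] /eqP dEt]; lia.
Qed.

Lemma sum_gbin_shadow_dual C i u : (u <= N)%N ->
  \sum_(U : {vspace 'rV[F]_N} | \dim U == u) gbin q (\dim (C :&: shadow U)) i
  = \sum_(0 <= j < i.+1)
      q ^ (j%:Z * ((\dim C)%:Z - c%:Z * (N%:Z - u%:Z) - i%:Z + j%:Z))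
      * gbin q ((\dim C)%:Z - c%:Z * (N%:Z - u%:Z)) (i - j)
      * \sum_(0 <= t < (N - u).+1) gbin q (N - t)%N u * (card_supp (dual C) j t)%:R.
Proof.
move=> uN.
pose e j := q ^ (j%:Z * ((\dim C)%:Z - c%:Z * (N%:Z - u%:Z) - i%:Z + j%:Z))
      * gbin q ((\dim C)%:Z - c%:Z * (N%:Z - u%:Z)) (i - j).
transitivity (\sum_(U : {vspace 'rV[F]_N} | \dim U == u)
   \sum_(0 <= j < i.+1) e j * gbin q (\dim (dual C :&: shadow (dual U))) j).
  (* Vandermonde with [a = \dim C - c * (N - u)], possibly negative, and
     [l = \dim (dual C :&: shadow (dual U))]; [dim_cap_dual] identifies [a + l]. *)
  apply: eq_bigr => U /eqP dU; rewrite big_mkord -gbin_vandermonde //.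
  congr (gbin _ _ _).
  have := dim_cap_dual _ _ _ C (shadow U); rewrite dual_shadow dim_shadow dU dim_total.
  nia.
rewrite exchange_big /=; apply: eq_bigr => j _; rewrite -mulr_sumr; congr (_ * _).
(* Dualizing is a bijection from dimension [u] to dimension [N - u], so the preceding count applies
   to [dual C], with lower index [N - (N - u) = u]. *)
have := sum_gbin_shadow (dual C) j (N - u) (leq_subr _ _).
rewrite subKn // => <-; rewrite [RHS](reindex_inj (can_inj (dualK F 1 N))) /=.
apply: eq_bigl => U; have := dim_dual _ _ _ U; rewrite mul1n => dU.
by apply/eqP/eqP; lia.
Qed.

Lemma card_supp_dual C i w : (w <= N)%N ->
  (card_supp C i w)%:R =
  \sum_(0 <= u < w.+1) (-1) ^+ (w - u) * q ^+ 'C(w - u, 2)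
    * gbin q (N - u)%N (N - w)
    * \sum_(0 <= j < i.+1)
      q ^ (j%:Z * ((\dim C)%:Z - c%:Z * (N%:Z - u%:Z) - i%:Z + j%:Z))
      * gbin q ((\dim C)%:Z - c%:Z * (N%:Z - u%:Z)) (i - j)
      * \sum_(0 <= t < (N - u).+1) gbin q (N - t)%N u * (card_supp (dual C) j t)%:R.
Proof.
move=> wN; rewrite -(gbin_inversion q q_gt1 N w (fun t => (card_supp C i t)%:R)) //.
apply: eq_big_nat => u /andP[_ uw]; have uN : (u <= N)%N by lia.
by rewrite -sum_gbin_shadow_dual // sum_gbin_shadow.
Qed.

Lemma card_supp_dual_qbinom C i w : (w <= N)%N ->
  (card_supp C i w)%:R =
  \sum_(0 <= u < w.+1)
    (-1) ^+ (w - u) * q ^+ 'C(w - u, 2)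
    * qbinom #|F| (N%:Z - u%:Z) (N%:Z - w%:Z)
    * \sum_(0 <= j < i.+1)
        (q ^+ (j * (\dim C + c * u + j)) / q ^+ (j * (c * N + i)))
        * qbinom #|F| ((\dim C)%:Z - c%:Z * (N%:Z - u%:Z)) (i%:Z - j%:Z)
        * \sum_(0 <= t < (N - u).+1)
            qbinom #|F| (N%:Z - t%:Z) u%:Z * (card_supp (dual C) j t)%:R.
Proof.
move=> wN; rewrite card_supp_dual //.
have F1 : (1 < #|F|)%N by exact: finNzRing_gt1.
apply: eq_big_nat => u /andP[_]; rewrite ltnS => uw; have uN := leq_trans uw wN.
rewrite (subzn wN) (subzn uN) !qbinomE //; congr (_ * _).
apply: eq_big_nat => j /andP[_]; rewrite ltnS => ji.
rewrite (subzn ji) qbinomE //; congr (_ * _ * _); last first.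
  apply: eq_big_nat => t /andP[_ tN]; have {}tN : (t <= N)%N by lia.
  by rewrite (subzn tN) qbinomE.
have q0 : q != 0 by rewrite gt_eqF // (lt_trans _ q_gt1).
(* The exponents agree: [j * (k + c * u + j) - j * (c * N + i) = j * (k - c * (N - u) - i + j)] with
   [k = \dim C]. *)
rewrite !exprnP invr_expz -expfzDr //; congr (_ ^ _).
by rewrite !(PoszD, PoszM) -(subzn uN); ring.
Qed.
End SupportSystem.

(** * Row and column supports as instances *)

Section Shadows.
Variables (F : finFieldType).

(** Taken as the image of right multiplication by a basis matrix of [U], which is injective and so
    yields the dimension; [mem_row_shadow] recovers the description by rows. *)
Definition row_shadow p r (U : {vspace 'rV[F]_r}) : {vspace 'M[F]_(p, r)} :=
  limg (linfun (mulmxr (\matrix_(l < \dim U) (vbasis U)`_l)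
                : 'M[F]_(p, \dim U) -> 'M[F]_(p, r))).

Lemma mem_row_shadow p r (U : {vspace 'rV[F]_r}) (M : 'M[F]_(p, r)) :
  reflect (forall l, row l M \in U) (M \in row_shadow p r U).
Proof.
apply: (iffP memv_imgP) => [[X _ ->] l | MU].
  rewrite lfunE /= row_mul mulmx_sum_row memv_suml // => s _.
  by rewrite memvZ // rowK vbasis_mem // mem_nth ?size_tuple.
exists (\matrix_(l, s) coord (vbasis U) s (row l M)); first exact: memvf.
rewrite lfunE /=; apply/row_matrixP => l.
rewrite row_mul mulmx_sum_row {1}(coord_vbasis (MU l)).
by apply: eq_bigr => s _; rewrite rowK !mxE.
Qed.

Lemma dim_row_shadow p r (U : {vspace 'rV[F]_r}) :
  \dim (row_shadow p r U) = (p * \dim U)%N.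
Proof.
have freeB : row_free (\matrix_(l < \dim U) (vbasis U)`_l).
  apply: inj_row_free => v; rewrite mulmx_sum_row => vB.
  have /freeP vbF := basis_free (vbasisP U).
  apply/rowP => l; rewrite mxE; apply: vbF l; rewrite -[RHS]vB.
  by apply: eq_bigr => l _; rewrite rowK.
rewrite limg_dim_eq ?dimvf //; apply/eqP; rewrite capfv -subv0.
apply/subvP => X; rewrite memv_ker lfunE /= memv0.
by rewrite mulmx_free_eq0.
Qed.

(** Each diagonal entry of [X *m M^T] pairs a row of [X] with a row of [M], which gives one
    inclusion; the dimensions agree. *)
Lemma dual_row_shadow p r (U : {vspace 'rV[F]_r}) :
  dual (row_shadow p r U) = row_shadow p r (dual U).
Proof.
apply/esym/eqP; rewrite eqEdim; apply/andP; split; last first.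
  have := dim_dual _ _ _ (row_shadow p r U); have := dim_dual _ _ _ U.
  by rewrite !dim_row_shadow; nia.
apply/subvP => M /mem_row_shadow MU; apply/dualP => X /mem_row_shadow XU.
rewrite /mxtrace big1 // => l _.
have /dualP/(_ _ (XU l)) := MU l; rewrite /mxtrace big_ord1 => <-.
by rewrite !mxE; apply: eq_bigr => s _; rewrite !mxE.
Qed.

Lemma rowsupp_shadow p r (E : {vspace 'M[F]_(p, r)}) U :
  (rowsupp E <= U)%VS = (E <= row_shadow p r U)%VS.
Proof.
apply/subv_sumP/subvP => [EU M ME | EU M ME].
  apply/mem_row_shadow => l; apply: (subvP (EU M ME)).
  by apply/memv_span/imageP; exists l.
apply/span_subvP => _ /imageP[l _ ->]; exact/mem_row_shadow/EU.
Qed.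

Definition col_shadow p r (U : {vspace 'rV[F]_p}) : {vspace 'M[F]_(p, r)} :=
  (linfun (@trmx F r p) @: row_shadow r p U)%VS.

Lemma mem_col_shadow p r (U : {vspace 'rV[F]_p}) (M : 'M[F]_(p, r)) :
  (M \in col_shadow p r U) = (M^T \in row_shadow r p U).
Proof.
apply/memv_imgP/idP => [[X XU ->]|MU]; first by rewrite lfunE /= trmxK.
by exists M^T; rewrite // lfunE /= trmxK.
Qed.

Lemma dim_col_shadow p r (U : {vspace 'rV[F]_p}) :
  \dim (col_shadow p r U) = (r * \dim U)%N.
Proof.
rewrite limg_dim_eq ?dim_row_shadow //; apply/eqP; rewrite -subv0.
apply/subvP => X; rewrite memv_cap memv_ker lfunE /= memv0 => /andP[_ /eqP X0].
by rewrite -[X]trmxK X0 trmx0.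
Qed.

(** Reduces to rows, since the trace form is unchanged when both arguments are transposed. *)
Lemma dual_col_shadow p r (U : {vspace 'rV[F]_p}) :
  dual (col_shadow p r U) = col_shadow p r (dual U).
Proof.
apply/vspaceP => M; rewrite mem_col_shadow -dual_row_shadow.
apply/dualP/dualP => MU X XU.
  rewrite trmxK mxtrace_mulC -mxtrace_tr trmx_mul MU //.
  by rewrite mem_col_shadow trmxK.
rewrite -mxtrace_tr trmx_mul trmxK mxtrace_mulC -[M]trmxK MU //.
by rewrite -mem_col_shadow.
Qed.

Lemma colsupp_shadow p r (E : {vspace 'M[F]_(p, r)}) U :
  (colsupp E <= U)%VS = (E <= col_shadow p r U)%VS.
Proof.
apply/subv_sumP/subvP => [EU M ME | EU M ME].
  rewrite mem_col_shadow; apply/mem_row_shadow => l; rewrite -tr_col.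
  by apply/(subvP (EU M ME))/memv_span/imageP; exists l.
apply/span_subvP => _ /imageP[l _ ->]; rewrite tr_col.
by apply/mem_row_shadow; rewrite -mem_col_shadow EU.
Qed.

End Shadows.

Theorem corollary7p4 (q : nat) (F : finFieldType) (hq : #|F| = q)
    (n m : nat) (hn : (2 <= n)%N) (hnm : (n <= m)%N)
    (C : {vspace 'M[F]_(n, m)}) (k : nat) (hk : \dim C = k)
    (i : nat) (hi : (i <= k)%N) (w : nat) (hw : (w <= n)%N) :
  gwdist C i w =
  \sum_(0 <= u < w.+1)
    (-1) ^+ (w - u) * q%:R ^+ 'C(w - u, 2)
    * qbinom q (n%:Z - u%:Z) (n%:Z - w%:Z)
    * \sum_(0 <= j < i.+1)
        (q%:R ^+ (j * (k + m * u + j)) / q%:R ^+ (j * (m * n + i)))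
        * qbinom q (k%:Z - m%:Z * (n%:Z - u%:Z)) (i%:Z - j%:Z)
        * \sum_(0 <= t < (n - u).+1)
            qbinom q (n%:Z - t%:Z) u%:Z * gwdist (dual C) j t.
Proof.
subst q k; rewrite {1}/gwdist.
have colE := card_supp_dual_qbinom F n m n m (@colsupp F n m) (@col_shadow F n m)
  (colsupp_shadow F n m) (dim_col_shadow F n m) (dual_col_shadow F n m)
  (mulnC n m) C i w hw.
case: ltnP => [nm|mn].
  rewrite card_supp_sum colE; apply: eq_bigr => u _; congr (_ * _).
  apply: eq_bigr => j _; congr (_ * _); apply: eq_bigr => t _; congr (_ * _).
  by rewrite /gwdist nm card_supp_sum.
have eq_mn : m = n by apply/eqP; rewrite eqn_leq mn.
subst m.
have rowE := card_supp_dual_qbinom F n n n n (@rowsupp F n n) (@row_shadow F n n)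
  (rowsupp_shadow F n n) (dim_row_shadow F n n) (dual_row_shadow F n n)
  (erefl _) C i w hw.
(* For [n = m] the column and row identities have the same coefficients, so the factor one half and
   the sum pass through the three nested sums down to the weight distribution of the dual. *)
rewrite -!natr_sum !card_supp_sum colE rowE -big_split mulr_sumr /=.
apply: eq_bigr => u _; rewrite -mulrDr mulrCA; congr (_ * _).
rewrite -big_split mulr_sumr /=.
apply: eq_bigr => j _; rewrite -mulrDr mulrCA; congr (_ * _).
rewrite -big_split mulr_sumr /=.
apply: eq_bigr => t _; rewrite -mulrDr mulrCA; congr (_ * _).
by rewrite /gwdist ltnn -!natr_sum !card_supp_sum.
Qed.
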